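(* For every integer $m\ge1$, $$\sum_{p=0}^{m-1}(-1)^{p+m-1}\genfrac{\{}{\}}{0pt}{}{p+m-1}{p}_{\ge 2}=(m-1)!.$$
   Context: $\genfrac{\{}{\}}{0pt}{}{n}{k}_{\ge 2}$ is the 2-associated Stirling subset number (second kind): the number of partitions of an $n$-element set into $k$ blocks each of size at least $2$ (with value $1$ for $n=k=0$). *)

(* Defs.v *)
From mathcomp Require Import all_boot.

Set Implicit Arguments.
Unset Strict Implicit.
Unset Printing Implicit Defensive.

(* 2-associated Stirling subset number: the number of set partitions of an
   n-element set into k blocks, each of size at least 2. MathComp's [partition]
   requires the blocks to be nonempty and pairwise disjoint with union the whole
   set, so the empty family is the one partition of the empty set. *)
Definition stirling2_ge2 (n k : nat) : nat :=
  #|[set P : {set {set 'I_n}} |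
      [&& partition P [set: 'I_n], #|P| == k & [forall B in P, 2 <= #|B|]]]|.

(* Main.v *)
Require Import Defs.
From mathcomp Require Import all_boot all_order all_algebra.
From mathcomp Require Import zify ring.
Import GRing.Theory.
Local Open Scope ring_scope.

(** Write S(n, k) for the 2-associated Stirling numbers. They satisfy
      S(n+2, k+1) = (k+1) S(n+1, k+1) + (n+1) S(n, k):
    fix a point x of the ground set; its block either has size at least 3, and
    deleting x leaves a partition together with one of its blocks, or it is a
    pair {x, y}, and deleting both points leaves a partition with one block
    fewer ([card_partitions_ge2_rec]).

    Put a(n, p) = S(n+p, p), so that, with n+1 for m, the left-hand side is
    T(n) = sum over p <= n of (-1)^(n+p) a(n, p). Along this diagonal the
    recurrence reads a(n+1, p+1) = (p+1) a(n, p+1) + (n+p+1) a(n, p). The signs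
    of the two contributions of a(n, p) to T(n+1) are opposite, so that its
    coefficient is (n+p+1) - p = n+1 up to the sign (-1)^(n+p). The boundary
    term a(n, n+1) = S(2n+1, n+1) vanishes, because n+1 blocks of size at least
    2 need 2n+2 points. Hence T(n+1) = (n+1) T(n), and T(0) = 1
    ([sum_stirling2_ge2_diagonal]).

    For the first recurrence, everything is reduced to one count: the
    partitions of A that have a given set C as a block correspond to the
    partitions of the complement of C in A ([card_partitions_ge2_block]). *)

(** Subsets of an arbitrary finite type are allowed as ground sets, so that
    deleting a point or a block does not change the type. *)
Definition partitions_ge2 {T : finType} (A : {set T}) (k : nat) :
    {set {set {set T}}} :=
  [set P | [&& partition P A, #|P| == k & [forall B in P, 2 <= #|B|]]]%N.

Lemma partitions_ge2_add_block (T : finType) (A C : {set T})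
    (Q : {set {set T}}) k :
  C \subset A -> (2 <= #|C|)%N -> Q \in partitions_ge2 (A :\: C) k ->
  (C \notin Q) /\ (C |: Q \in partitions_ge2 A k.+1).
Proof.
move=> sCA C2; rewrite !inE => /and3P[partQ /eqP cardQ /forall_inP Q2].
have C0 : C != set0 by rewrite -card_gt0; apply: leq_trans C2.
have CQ : C \notin Q.
  apply/negP => CQ; have /set0Pn[z zC] := C0.
  have /subsetP/(_ z zC) := partitionS partQ CQ.
  by rewrite inE zC.
split=> //; apply/and3P; split.
- rewrite -(setID A C) (setIidPr sCA); apply: partitionU1 => //.
  by rewrite disjoints_subset setCD subsetUr.
- by rewrite cardsU1 CQ cardQ.
- by apply/forall_inP => B; rewrite inE in_set1 => /orP[/eqP-> //|/Q2].
Qed.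

Lemma partitions_ge2_remove_block (T : finType) (A C : {set T})
    (P : {set {set T}}) k :
  C \in P -> P \in partitions_ge2 A k.+1 ->
  P :\ C \in partitions_ge2 (A :\: C) k.
Proof.
move=> CP; rewrite !inE => /and3P[partP /eqP cardP /forall_inP P2].
apply/and3P; split.
- exact: partitionD1.
- by move: cardP; rewrite (cardsD1 C) CP add1n => -[->].
- by apply/forall_inP => B /setD1P[_ /P2].
Qed.

(** Adding the block C and removing it are mutually inverse. The bound on the
    size of C makes C nonempty, so that it cannot already be a block of a
    partition of the complement. *)
Lemma card_partitions_ge2_block (T : finType) (A C : {set T}) k :
  C \subset A -> (2 <= #|C|)%N ->
  #|[set P in partitions_ge2 A k.+1 | C \in P]|
    = #|partitions_ge2 (A :\: C) k|.
Proof.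
move=> sCA C2; symmetry.
rewrite -(card_in_imset (f := fun Q => C |: Q)); last first.
  move=> Q1 Q2 /(partitions_ge2_add_block _ _ _ _ _ sCA C2)[CQ1 _].
  move=> /(partitions_ge2_add_block _ _ _ _ _ sCA C2)[CQ2 _] eqQ.
  by rewrite -(setU1K CQ1) eqQ setU1K.
congr #|pred_of_set _|; apply/setP => P; apply/imsetP/setIdP.
- move=> [Q /(partitions_ge2_add_block _ _ _ _ _ sCA C2)[_ QP] ->].
  by split=> //; rewrite setU11.
- move=> [PA CP]; exists (P :\ C); last by rewrite setD1K.
  exact: partitions_ge2_remove_block.
Qed.

(** Double counting of the pairs formed by a partition and one of its blocks. *)
Lemma card_partitions_ge2_mul (T : finType) (A : {set T}) k :
  (k.+1 * #|partitions_ge2 A k.+1| =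
   \sum_(C : {set T} | (C \subset A) && (2 <= #|C|))
     #|partitions_ge2 (A :\: C) k|)%N.
Proof.
transitivity (\sum_(P in partitions_ge2 A k.+1) \sum_(C in P) 1)%N.
  rewrite mulnC -sum_nat_const; apply: eq_bigr => P.
  by rewrite inE sum1_card => /and3P[_ /eqP-> _].
rewrite (exchange_big_dep (fun C : {set T} => (C \subset A) && (2 <= #|C|)%N)).
  apply: eq_bigr => C /andP[sCA C2]; rewrite -card_partitions_ge2_block //.
  by rewrite -sum1_card; apply: eq_bigl => P; rewrite inE.
move=> P C; rewrite inE => /and3P[partP _ /forall_inP P2] CP.
by rewrite (partitionS partP CP) P2.
Qed.

(** Classification of the partitions by the block that contains x. *)
Lemma card_partitions_ge2_point (T : finType) (A : {set T}) x k :
  x \in A ->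
  (#|partitions_ge2 A k.+1| =
   \sum_(C : {set T} | [&& C \subset A, 2 <= #|C| & x \in C])
     #|partitions_ge2 (A :\: C) k|)%N.
Proof.
move=> xA.
rewrite -sum1_card (partition_big (fun P => pblock P x)
  (fun C : {set T} => [&& C \subset A, (2 <= #|C|)%N & x \in C])) /=.
  apply: eq_bigr => C /and3P[sCA C2 xC].
  rewrite -card_partitions_ge2_block // -sum1_card; apply: eq_bigl => P.
  rewrite [RHS]inE; apply: andb_id2l; rewrite inE => /and3P[partP _ _].
  have [/eqP covP tiP _] := and3P partP.
  apply/eqP/idP => [<-|CP]; last exact: def_pblock.
  by rewrite pblock_mem // covP.
move=> P; rewrite inE => /and3P[partP _ /forall_inP P2].
have [/eqP covP tiP _] := and3P partP.
have xcov : x \in cover P by rewrite covP.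
by rewrite (partitionS partP) ?P2 ?mem_pblock ?pblock_mem.
Qed.

(** In the classification by the block C of x, write C as x added to a nonempty
    subset B of A minus x. The sets B with at least two elements give the double
    count of [card_partitions_ge2_mul] on A minus x, which is the first term;
    the singletons give the second. *)
Lemma card_partitions_ge2_rec (T : finType) (A : {set T}) x k :
  x \in A ->
  (#|partitions_ge2 A k.+1| =
   k.+1 * #|partitions_ge2 (A :\ x) k.+1|
   + \sum_(y in A :\ x) #|partitions_ge2 (A :\ x :\ y) k|)%N.
Proof.
move=> xA; rewrite (card_partitions_ge2_point _ _ x) // card_partitions_ge2_mul.
rewrite (reindex_onto (fun B => x |: B) (fun C => C :\ x)) /=; last first.
  by move=> C /and3P[_ _ xC]; rewrite setD1K.
rewrite (eq_bigl (fun B : {set T} => (B \subset A :\ x) && (1 <= #|B|)%N));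
  last first.
  (* The condition that removing x from x |: B gives back B says x \notin B. *)
  move=> B; rewrite subsetD1 subUset sub1set xA setU11 /= andbT.
  have [xB|xB] := boolP (x \in B).
    rewrite andbF; apply/negbTE; rewrite negb_and orbC.
    by apply/orP; left; apply/eqP => E; move: xB; rewrite -E setD11.
  by rewrite setU1K // eqxx cardsU1 xB add1n ltnS !andbT.
rewrite (bigID (fun B : {set T} => (2 <= #|B|)%N)) /=; congr (_ + _)%N.
  apply: eq_big => [B|B _]; last by rewrite setDDl.
  by case: (_ \subset _) => //=; case: #|B| => [|[]].
transitivity (\sum_(B in [set [set y] | y in A :\ x])
                #|partitions_ge2 (A :\ x :\: B) k|)%N.
  apply: eq_big => [B|B _]; last by rewrite setDDl.
  apply/idP/imsetP => [/andP[/andP[sB B1] B2]|[y yA ->]].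
    have /cards1P[y By] : #|B| == 1%N by rewrite eqn_leq B1 andbT leqNgt.
    by exists y => //; rewrite -sub1set -By.
  by rewrite sub1set yA cards1.
by rewrite big_imset //= => y z _ _ /set1_inj.
Qed.

(** The recurrence taken as a definition: it makes it visible that the number of
    partitions depends on the ground set only through its size. For n = 1 the
    recurrence gives 0, which is the default branch. *)
Fixpoint stirling2_ge2_rec (n k : nat) : nat :=
  match n, k with
  | 0, 0 => 1
  | (n'.+1 as n1).+1, k'.+1 =>
      k * stirling2_ge2_rec n1 k + n1 * stirling2_ge2_rec n' k'
  | _, _ => 0
  end.

Lemma card_partitions_ge2 (T : finType) (A : {set T}) k :
  #|partitions_ge2 A k| = stirling2_ge2_rec #|A| k.
Proof.
have [n] := ubnP #|A|; elim: n A k => // n IHn A [_|k ltAn].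
  (* No block: the empty family is a partition of the empty set only. *)
  transitivity (A == set0 : nat); last first.
    by rewrite -cards_eq0; case: #|A| => [|[]].
  transitivity #|[set P : {set {set T}} | (P == set0) && (A == set0)]|.
    congr #|pred_of_set _|; apply/setP => P; rewrite !inE cards_eq0.
    have [->|_] := eqVneq P set0; last by rewrite andbF.
    have -> : [forall B in set0, 1 < #|B : {set T}|]%N.
      by apply/forall_inP => B; rewrite inE.
    rewrite /partition /trivIset /cover !big_set0 cards0 eqxx inE.
    by rewrite !andbT eq_sym.
  case: (A == set0).
    rewrite [RHS]/= -(cards1 (set0 : {set {set T}})); congr #|pred_of_set _|.
    by apply/setP => P; rewrite !inE andbT.
  by apply/eqP; rewrite cards_eq0; apply/eqP/setP => P; rewrite !inE andbF.
have [->|[x xA]] := set_0Vmem A.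
  rewrite cards0 /=; apply/eqP; rewrite cards_eq0 -subset0.
  apply/subsetP => P; rewrite !inE => /and3P[partP].
  have [->|[B BP]] := set_0Vmem P; first by rewrite cards0.
  move=> _ /forall_inP/(_ B BP); have := subset_leq_card (partitionS partP BP).
  by rewrite cards0 leqn0 => /eqP->.
have cardAx : #|A| = #|A :\ x|.+1 by rewrite (cardsD1 x) xA.
rewrite (card_partitions_ge2_rec _ _ x) // IHn -?cardAx // cardAx.
(* The predecessor is meaningful in every term of the sum: a term exists only
   if A has a point other than x. *)
rewrite (eq_bigr (fun=> stirling2_ge2_rec #|A :\ x|.-1 k)) => [|y yA].
  rewrite sum_nat_const; case: #|A :\ x| => [|a] //=.
  by rewrite mul0n muln0.
rewrite (cardsD1 y (A :\ x)) yA /= IHn //.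
by move: ltAn; rewrite cardAx (cardsD1 y (A :\ x)) yA; lia.
Qed.

Lemma stirling2_ge2_recE n k : stirling2_ge2 n k = stirling2_ge2_rec n k.
Proof. by rewrite -[n in RHS]card_ord -cardsT -card_partitions_ge2. Qed.

Lemma stirling2_ge2_recS0 n : stirling2_ge2_rec n.+1 0 = 0%N.
Proof. by case: n. Qed.

Lemma stirling2_ge2_recSS n k :
  stirling2_ge2_rec n.+2 k.+1 =
  (k.+1 * stirling2_ge2_rec n.+1 k.+1 + n.+1 * stirling2_ge2_rec n k)%N.
Proof. by []. Qed.

Lemma stirling2_ge2_rec_small n k :
  (n < k.*2)%N -> stirling2_ge2_rec n k = 0%N.
Proof.
have [b] := ubnP n; elim: b n k => // b IHb [|[|n]] [|k] // ltnb ltnk.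
by rewrite stirling2_ge2_recSS !IHb ?muln0 //; lia.
Qed.

(** The sum is T(n); the induction step is T(n+1) = (n+1) T(n). *)
Lemma sum_stirling2_ge2_diagonal n :
  \sum_(0 <= p < n.+1) (-1) ^+ (n + p)%N * (stirling2_ge2_rec (n + p) p)%:Z
  = n`!%:Z.
Proof.
elim: n => [|n IHn]; first by rewrite big_nat1.
rewrite big_nat_recl // addn0 stirling2_ge2_recS0 mulr0 add0r.
set a := fun p => (stirling2_ge2_rec (n + p) p)%:Z.
(* Each term of T(n+1) is n+1 times a term of T(n), minus a difference of
   consecutive values of (-1)^(n+p) p a(n, p), so that the sum telescopes. *)
have step p : (-1) ^+ (n.+1 + p.+1)%N
      * (stirling2_ge2_rec (n.+1 + p.+1) p.+1)%:Z
    = (-1) ^+ (n + p)%N * (n.+1%:Z * a p)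
      - ((-1) ^+ (n + p.+1)%N * (p.+1%:Z * a p.+1)
         - (-1) ^+ (n + p)%N * (p%:Z * a p)).
  rewrite /a !addSn !addnS stirling2_ge2_recSS !exprS.
  by rewrite PoszD !PoszM !intS PoszD; ring.
rewrite (eq_bigr _ (fun p _ => step p)) sumrB telescope_sumr //.
have -> : a n.+1 = 0 by rewrite /a stirling2_ge2_rec_small //; lia.
rewrite mul0r !mulr0 !subr0 factS PoszM -IHn mulr_sumr.
by apply: eq_bigr => p _; rewrite mulrCA.
Qed.

Theorem mainTheorem15 (m : nat) (hm : (1 <= m)%N) :
  \sum_(0 <= p < m)
     (-1) ^+ (p + m - 1)%N * (stirling2_ge2 (p + m - 1)%N p)%:Z
  = ((m - 1)%N`!)%:Z :> int.
Proof.
case: m hm => // n _; rewrite subn1 -sum_stirling2_ge2_diagonal.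
by apply: eq_bigr => p _; rewrite stirling2_ge2_recE addnS subn1 addnC.
Qed.
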